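(* Let $\{P_k\}_{k\ge1}$ be a sequence of binary matrices, where $P_k$ has $m_k$ rows and $n_k$ columns and $m_k\to\infty$, $n_k\to\infty$ as $k\to\infty$. Then there exist a subsequence $\{P_{k_l}\}_{l\ge1}$ and an asymmetric graphon $W$ such that $\delta_\Box(P_{k_l},W)\to0$ as $l\to\infty$.
   Context: A binary matrix is a real matrix all of whose entries are $0$ or $1$. For an $m\times n$ real matrix $A$, the (normalized) cut norm is $\|A\|_\Box:=\frac{1}{mn}\max\{|x^TAy|: x\in\mathbb{R}^m, y\in\mathbb{R}^n, \|x\|_\infty\le1, \|y\|_\infty\le1\}$. For permutations $\pi$ of $\{1,\dots,m\}$ and $\tau$ of $\{1,\dots,n\}$, $A^{\pi,\tau}$ is the $m\times n$ matrix with $(i,j)$ entry $a_{\pi(i)\tau(j)}$. For two $m\times n$ matrices, $\delta_\Box(A,B):=\min_{\pi,\tau}\|A^{\pi,\tau}-B\|_\Box$, the minimum being over all permutations $\pi$ of the rows and $\tau$ of the columns. An asymmetric graphon is a Borel measurable function $W:[0,1]^2\to[0,1]$ (not necessarily symmetric). Its $m\times n$ discrete approximation $W_{m,n}$ is the $m\times n$ matrix whose $(i,j)$ entry is $mn\int_{(i-1)/m}^{i/m}\int_{(j-1)/n}^{j/n}W(x,y)\,dy\,dx$. For an $m\times n$ matrix $A$, $\delta_\Box(A,W):=\delta_\Box(A,W_{m,n})$. A sequence of matrices $A_k$ converges to $W$ if $\delta_\Box(A_k,W)\to0$. *)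

(* Defs.v *)
From HB Require Import structures.
From mathcomp Require Import all_boot all_order all_algebra all_fingroup.
From mathcomp Require Import all_classical all_reals all_analysis.
Set Implicit Arguments. Unset Strict Implicit. Unset Printing Implicit Defensive.
Import Order.TTheory GRing.Theory Num.Theory.
Local Open Scope classical_set_scope.
Local Open Scope ring_scope.

Section Defs.
Variable R : realType.

Definition binary_mx (m n : nat) (A : 'M[R]_(m, n)) : Prop :=
  forall i j, A i j = 0 \/ A i j = 1.

(* normalized cut norm: (1/(mn)) max { |x^T A y| : ||x||_oo <= 1, ||y||_oo <= 1 }
   (the max is attained, so it is the supremum of this set) *)
Definition cut_norm (m n : nat) (A : 'M[R]_(m, n)) : R :=
  (m%:R * n%:R)^-1 *
  sup [set r : R | exists (x : 'I_m -> R) (y : 'I_n -> R),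
        (forall i, `|x i| <= 1) /\ (forall j, `|y j| <= 1) /\
        r = `| \sum_(i < m) \sum_(j < n) x i * A i j * y j |].

Definition perm_rc (m n : nat) (A : 'M[R]_(m, n)) (pi : 'S_m) (tau : 'S_n)
  : 'M[R]_(m, n) := \matrix_(i, j) A (pi i) (tau j).

(* delta_Box(A,B) = min over row/column permutations (finite nonempty set,
   so the infimum is the minimum) *)
Definition delta_box (m n : nat) (A B : 'M[R]_(m, n)) : R :=
  inf [set r : R | exists (pi : 'S_m) (tau : 'S_n),
        r = cut_norm (perm_rc A pi tau - B)].

Definition asym_graphon (W : R * R -> R) : Prop :=
  measurable_fun (`[0%R, 1%R]%classic `*` `[0%R, 1%R]%classic : set (R * R)) W /\
  forall x y, 0 <= x <= 1 -> 0 <= y <= 1 -> 0 <= W (x, y) <= 1.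

Definition discr_approx (m n : nat) (W : R * R -> R) : 'M[R]_(m, n) :=
  \matrix_(i < m, j < n)
    (m%:R * n%:R *
     Rintegral (@lebesgue_measure R) `[(i%:R / m%:R), (i.+1%:R / m%:R)]
       (fun x => Rintegral (@lebesgue_measure R)
                   `[(j%:R / n%:R), (j.+1%:R / n%:R)] (fun y => W (x, y)))).

Definition delta_box_W (m n : nat) (A : 'M[R]_(m, n)) (W : R * R -> R) : R :=
  delta_box A (discr_approx m n W).

End Defs.

(* Main.v *)
(** Starting from the trivial partition, refine the rows and columns of each
matrix P_k greedily, splitting every class by the signs of a vector pair that
witnesses the cut norm of the error of the current block average. The cut-norm
error at level s is at most the L1 distance between the averages of levels s and
s + 1, whose square is at most the gain in energy (mean square of the block
averages), and energies lie in [0, 1]. Sorting rows and columns by class turns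
the level-s average into a step function on the unit square. Along an
ultrafilter on the indices k, its breakpoints, values and energy converge for
every s, which gives a limit step function W_s. Levels s_j whose limit energy
is within 4^-j of the supremum form a sequence with L1 gaps at most 2^-j, and
the upper limit W of W_{s_j} is the desired graphon. *)
Require Import Defs.
From HB Require Import structures.
From mathcomp Require Import all_boot all_order all_algebra all_fingroup.
From mathcomp Require Import all_classical all_reals all_analysis.
From mathcomp Require Import measurable_realfun zify ring lra.
Import Order.TTheory GRing.Theory Num.Theory numFieldNormedType.Exports.
Local Open Scope classical_set_scope.
Local Open Scope ring_scope.

(** * Block averages on a finite set and their energy *)

Section BlockAverage.
Context {R : realFieldType} {T : finType}.
Implicit Types (g a : T -> R).

(** The conditional expectation of [g] given [f], indexed by the value of [f]. An empty class gets
    the value 0. *)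
Definition bavg {K : eqType} (f : T -> K) g (p : K) : R :=
  (\sum_(u | f u == p) g u) / #|[pred u | f u == p]|%:R.

(** The defining property of conditional expectation. After exchanging the sums, each [v]
    contributes [g v * h (f v)] once per member of its class, divided by the size of that class,
    which is nonzero because the class contains [v]. *)
Lemma bavg_orth {K : eqType} (f : T -> K) g (h : K -> R) :
  \sum_u bavg f g (f u) * h (f u) = \sum_u g u * h (f u).
Proof.
have H u : bavg f g (f u) * h (f u) =
    \sum_(v | f v == f u) g v * h (f v) / #|[pred w | f w == f v]|%:R.
  rewrite /bavg mulrAC !mulr_suml.
  by apply: eq_bigr => v /eqP ->.
rewrite (eq_bigr _ (fun u _ => H u)) (exchange_big_dep predT) //=.
apply: eq_bigr => v _; rewrite sumr_const -[LHS]mulr_natr.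
rewrite (eq_card (B := [pred w | f w == f v])); last first.
  by move=> w; rewrite !inE eq_sym.
rewrite divfK // pnatr_eq0 -lt0n; apply/card_gt0P; exists v.
by rewrite inE eqxx.
Qed.

Lemma bavg_itv {K : eqType} (f : T -> K) g p :
  (forall u, 0 <= g u <= 1) -> 0 <= bavg f g p <= 1.
Proof.
move=> g01; have g0 u : 0 <= g u by case/andP: (g01 u).
rewrite /bavg divr_ge0 ?sumr_ge0 //=.
set N : nat := #|_|; have [->|N0] := posnP N; first by rewrite invr0 mulr0.
rewrite ler_pdivrMr ?ltr0n // mul1r.
apply: (@le_trans _ _ (\sum_(u | f u == p) 1)).
  by apply: ler_sum => u _; case/andP: (g01 u).
by rewrite sumr_const.
Qed.

Definition energy {K : eqType} (f : T -> K) g : R :=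
  (\sum_u bavg f g (f u) ^+ 2) / #|T|%:R.

Lemma energy_itv {K : eqType} (f : T -> K) g :
  (forall u, 0 <= g u <= 1) -> 0 <= energy f g <= 1.
Proof.
move=> g01; rewrite /energy divr_ge0 ?sumr_ge0 //= => [|u _]; last exact: sqr_ge0.
have [->|N0] := posnP #|T|; first by rewrite invr0 mulr0.
rewrite ler_pdivrMr ?ltr0n // mul1r.
apply: (@le_trans _ _ (\sum_(u : T) 1)).
  apply: ler_sum => u _; have /andP[b0 b1] := bavg_itv f g (f u) g01.
  by rewrite expr2; apply: mulr_ile1.
by rewrite sumr_const.
Qed.

(** Cauchy-Schwarz against the constant function: with [N], [s], [q] as in the proof, the sum of the
    squares [(N * |a u| - s)^2] equals [N * (N * q - s^2)]. *)
Lemma sum_normr_sqr a : (\sum_u `|a u|) ^+ 2 <= #|T|%:R * \sum_u a u ^+ 2.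
Proof.
set s := \sum_u `|a u|; set q := \sum_u _; set N : R := #|T|%:R.
have : 0 <= \sum_u (N * `|a u| - s) ^+ 2 by apply: sumr_ge0 => u _; exact: sqr_ge0.
under eq_bigr => u _.
  rewrite (_ : _ ^+ 2 = N ^+ 2 * a u ^+ 2 - (2 * N * s) * `|a u| + s ^+ 2); last first.
    by rewrite -(real_normK (num_real (a u))); ring.
  over.
rewrite big_split /= big_split /= sumrN -!mulr_sumr sumr_const -/s -/q -mulr_natr -/N.
have [N0|N0] := posnP #|T|.
  by rewrite /N N0 mul0r /s big1 ?expr0n // => u; have /card0_eq/(_ u) := N0.
have NR0 : 0 < N by rewrite ltr0n.
rewrite (_ : _ + _ = N * (N * q - s ^+ 2)); last by ring.
by rewrite pmulr_rge0 // subr_ge0.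
Qed.

Definition adist {K K' : eqType} (f : T -> K) (f' : T -> K') g : R :=
  (\sum_u `|bavg f' g (f' u) - bavg f g (f u)|) / #|T|%:R.

(* Block averages are orthogonal projections onto block functions, so
   refining the partition changes them by the increment of the energy. *)
Lemma adist_sqr_le {K K' : eqType} (f : T -> K) (f' : T -> K') (h : K' -> K) g :
  (forall u, f u = h (f' u)) ->
  adist f f' g ^+ 2 <= energy f' g - energy f g.
Proof.
move=> fh; rewrite /adist /energy -mulrBl.
have -> : \sum_u bavg f' g (f' u) ^+ 2 - \sum_u bavg f g (f u) ^+ 2 =
    \sum_u (bavg f' g (f' u) - bavg f g (f u)) ^+ 2.
  (* The cross term of Pythagoras: the coarse average is a function of [f'] through [h], so both the
     fine average and [g] itself pair with it in the same way. *)
  have E : \sum_u bavg f' g (f' u) * bavg f g (f u) = \sum_u bavg f g (f u) ^+ 2.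
    transitivity (\sum_u g u * bavg f g (f u)).
      under eq_bigr do rewrite fh.
      rewrite (bavg_orth f' g (bavg f g \o h)).
      by apply: eq_bigr => u _; rewrite fh.
    by rewrite -(bavg_orth f g (bavg f g)).
  under [RHS]eq_bigr do rewrite sqrrB.
  rewrite big_split /= sumrB /= sumrMnl E; ring.
have [->|N0] := posnP #|T|; first by rewrite invr0 !mulr0 expr0n.
have NR0 : (0 : R) < #|T|%:R by rewrite ltr0n.
rewrite exprMn exprVn ler_pdivrMr ?exprn_gt0 //.
rewrite [leRHS](_ : _ = #|T|%:R * \sum_u (bavg f' g (f' u) - bavg f g (f u)) ^+ 2).
  exact: sum_normr_sqr.
by field; rewrite gt_eqF.
Qed.

End BlockAverage.

(** * Bilinear forms, the cut norm and the cut distance *)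

Section CutForm.
Context {R : realType} {m n : nat}.
Implicit Types (A B C : 'M[R]_(m, n)) (x : 'I_m -> R) (y : 'I_n -> R).

Lemma entry_subE A B i j : (A - B) i j = A i j - B i j.
Proof. by rewrite !mxE. Qed.

Definition bform B x y : R := \sum_(i < m) \sum_(j < n) x i * B i j * y j.

(** A bound on the cut norm without the factor 1/(mn) and without a supremum, so that estimates can
    be added directly. *)
Definition cut_le B (M : R) : Prop :=
  forall x y, (forall i, `|x i| <= 1) -> (forall j, `|y j| <= 1) ->
  `|bform B x y| <= M.

Lemma bform_pair B x y : bform B x y = \sum_u B u.1 u.2 * (x u.1 * y u.2).
Proof.
rewrite /bform pair_big; apply: eq_bigr => u _ /=; ring.
Qed.

Lemma bform0 B : bform B (fun=> 0) (fun=> 0) = 0.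
Proof. by rewrite bform_pair big1 // => u _; rewrite !mulr0. Qed.

Lemma cut_le_sum B : cut_le B (\sum_u `|B u.1 u.2|).
Proof.
move=> x y x1 y1; rewrite bform_pair; apply: le_trans (ler_norm_sum _ _ _) _.
apply: ler_sum => u _; rewrite !normrM ler_piMr //.
by apply: mulr_ile1.
Qed.

Lemma cut_leD B C M N : cut_le B M -> cut_le C N -> cut_le (B + C) (M + N).
Proof.
move=> BM CN x y x1 y1.
have -> : bform (B + C) x y = bform B x y + bform C x y.
  rewrite !bform_pair -big_split; apply: eq_bigr => u _ /=.
  by rewrite mxE mulrDl.
by apply: le_trans (ler_normD _ _) _; rewrite lerD ?BM ?CN.
Qed.

(** The permutations move to the test vectors as inverses, and permuted vectors stay in the cube. *)
Lemma cut_le_perm B M (s : 'S_m) (t : 'S_n) :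
  cut_le B M -> cut_le (perm_rc B s t) M.
Proof.
move=> BM x y x1 y1.
have -> : bform (perm_rc B s t) x y =
    bform B (fun i => x ((s^-1)%g i)) (fun j => y ((t^-1)%g j)).
  rewrite /bform [RHS](reindex_inj (@perm_inj _ s)).
  apply: eq_bigr => i _; rewrite [RHS](reindex_inj (@perm_inj _ t)).
  by apply: eq_bigr => j _; rewrite !permK mxE.
by apply: BM.
Qed.

Definition sgnb (b : bool) : R := if b then 1 else -1.

Lemma sgnb_le1 b : `|sgnb b| <= 1.
Proof. by case: b; rewrite /sgnb ?normrN normr1. Qed.

Definition sform B (z : {ffun 'I_m -> bool} * {ffun 'I_n -> bool}) : R :=
  bform B (sgnb \o z.1) (sgnb \o z.2).

Definition best_sign B : {ffun 'I_m -> bool} * {ffun 'I_n -> bool} :=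
  [arg max_(z > ([ffun=> true], [ffun=> true])) `|sform B z| ]%O.

Lemma sum_le_sgnb (I : finType) (x r : I -> R) :
  (forall i, `|x i| <= 1) ->
  \sum_i x i * r i <= \sum_i sgnb ([ffun i => 0 <= r i] i) * r i.
Proof.
move=> x1; apply: ler_sum => i _; rewrite ffunE /sgnb.
have := x1 i; rewrite ler_norml => /andP[xl xr].
by case: ifPn => [r0|]; rewrite -?ltNge; nra.
Qed.

(* A bilinear form attains its maximum over a product of cubes at vertices. *)
Lemma bform_le_sform B x y :
  (forall i, `|x i| <= 1) -> (forall j, `|y j| <= 1) ->
  exists z, bform B x y <= sform B z.
Proof.
move=> x1 y1.
(* First [x] is optimised for the given [y], then [y] for the new sign vector; each time the form is
   linear in the vector being replaced. *)
pose r i := \sum_(j < n) B i j * y j; pose a := [ffun i => 0 <= r i].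
pose q j := \sum_(i < m) sgnb (a i) * B i j; pose b := [ffun j => 0 <= q j].
exists (a, b); apply: (@le_trans _ _ (bform B (sgnb \o a) y)).
  have H x' : bform B x' y = \sum_i x' i * r i.
    apply: eq_bigr => i _; rewrite mulr_sumr.
    by apply: eq_bigr => j _; rewrite mulrA.
  rewrite !H; exact: sum_le_sgnb.
have H y' : bform B (sgnb \o a) y' = \sum_j y' j * q j.
  rewrite /bform exchange_big; apply: eq_bigr => j _.
  by rewrite mulrC mulr_suml.
rewrite /sform !H /=; exact: sum_le_sgnb.
Qed.

Lemma cut_le_best B : cut_le B `|sform B (best_sign B)|.
Proof.
have best z : `|sform B z| <= `|sform B (best_sign B)|.
  by rewrite /best_sign; case: Order.TotalTheory.arg_maxP => //= z0 _; exact.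
move=> x y x1 y1; rewrite ler_norml; apply/andP; split.
  (* The lower bound is the upper bound at [- x], since the form is odd in [x]. *)
  have [z Hz] := @bform_le_sform B (fun i => - x i) y
    (fun i => eq_ind_r (fun t => t <= 1) (x1 i) (normrN (x i))) y1.
  rewrite lerNl; apply: le_trans (best z); apply: le_trans (ler_norm _).
  apply: le_trans Hz; rewrite /bform -sumrN; apply: ler_sum => i _.
  by rewrite -sumrN; apply: ler_sum => j _; rewrite !mulNr.
have [z Hz] := @bform_le_sform B x y x1 y1.
by apply: le_trans (best z); apply: le_trans (ler_norm _).
Qed.

Lemma cut_norm_ge0 B : 0 <= cut_norm B.
Proof.
rewrite /cut_norm mulr_ge0 ?invr_ge0 ?mulr_ge0 //.
(* The zero vectors put 0 into the set, and the sum of the absolute entries bounds the set, as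
   needed for [sup] to be an upper bound. *)
apply: ub_le_sup.
  by exists (\sum_u `|B u.1 u.2|) => r [x [y [x1 [y1 ->]]]]; exact: cut_le_sum.
exists (fun=> 0), (fun=> 0); do ![split; first by move=> i; rewrite normr0].
by have := bform0 B; rewrite /bform => ->; rewrite normr0.
Qed.

Lemma cut_norm_le B M : cut_le B M -> cut_norm B <= M / (m%:R * n%:R).
Proof.
move=> BM; rewrite /cut_norm mulrC ler_wpM2r ?invr_ge0 ?mulr_ge0 //.
apply: ge_sup; last by move=> r [x [y [x1 [y1 ->]]]]; exact: BM.
by eexists; exists (fun=> 0), (fun=> 0); split; [|split; [|reflexivity]];
  move=> i; rewrite normr0.
Qed.

Lemma delta_box_ge0 A B : 0 <= delta_box A B.
Proof.
apply: lb_le_inf; last by move=> r [s [t ->]]; exact: cut_norm_ge0.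
by eexists; exists 1%g, 1%g.
Qed.

Lemma delta_box_le A B s t M :
  cut_le (perm_rc A s t - B) M -> delta_box A B <= M / (m%:R * n%:R).
Proof.
move=> /cut_norm_le; apply: le_trans; apply: ge_inf; last by exists s, t.
by exists 0 => r [s' [t' ->]]; exact: cut_norm_ge0.
Qed.

End CutForm.

(** * Weak regularity by greedy refinement *)

Section WeakRegularity.
Context {R : realType} {m n : nat}.
Variable A : 'M[R]_(m, n).

Definition rckey (f : ('I_m -> nat) * ('I_n -> nat)) (u : 'I_m * 'I_n) :=
  (f.1 u.1, f.2 u.2).

Definition entry (u : 'I_m * 'I_n) := A u.1 u.2.

Definition avg_mx f : 'M[R]_(m, n) :=
  \matrix_(i, j) bavg (rckey f) entry (f.1 i, f.2 j).

(* The new low bit of a code is the sign of its row or column in a vector pair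
   witnessing the cut norm of the current error. *)
Definition refine f : ('I_m -> nat) * ('I_n -> nat) :=
  let z := best_sign (A - avg_mx f) in
  ((fun i => ((f.1 i).*2 + z.1 i)%N), (fun j => ((f.2 j).*2 + z.2 j)%N)).

Definition codes s := iter s refine (fun=> 0%N, fun=> 0%N).

Lemma codes_lt s : (forall i, (codes s).1 i < 2 ^ s)%N /\
  (forall j, (codes s).2 j < 2 ^ s)%N.
Proof.
elim: s => [|s [IH1 IH2]] /=; first by [].
split=> i; rewrite expnS /refine /=.
  by move: (IH1 i) (leq_b1 ((best_sign (A - avg_mx (codes s))).1 i)); lia.
by move: (IH2 i) (leq_b1 ((best_sign (A - avg_mx (codes s))).2 i)); lia.
Qed.

(** Each refinement appends one low bit, so dropping the last [k] bits recovers the code [k] levels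
    earlier. This makes the partitions nested and lets a sorting of a fine level sort the coarse
    ones. *)
Lemma codes_div s k : (forall i, (codes s).1 i = (codes (k + s)).1 i %/ 2 ^ k)%N /\
  (forall j, (codes s).2 j = (codes (k + s)).2 j %/ 2 ^ k)%N.
Proof.
elim: k => [|k [IH1 IH2]]; first by split=> i; rewrite expn0 divn1.
by split=> i; rewrite ?IH1 ?IH2 addSn expnS divnMA divn2 /codes iterS
  -/(codes (k + s)) /refine /= [(_.*2 + _)%N]addnC half_bit_double.
Qed.

Definition level_dist s t : R := adist (rckey (codes s)) (rckey (codes t)) entry.

Definition level_energy s : R := energy (rckey (codes s)) entry.

Lemma level_distC s t : level_dist s t = level_dist t s.
Proof.
by rewrite /level_dist /adist; congr (_ / _); apply: eq_bigr => u _; rewrite distrC.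
Qed.

Lemma level_dist_sqr_le s t : (s <= t)%N ->
  level_dist s t ^+ 2 <= level_energy t - level_energy s.
Proof.
move=> st; have [r c] := codes_div s (t - s); rewrite subnK // in r c.
apply: (@adist_sqr_le _ _ _ _ _ _
  (fun p => (p.1 %/ 2 ^ (t - s), p.2 %/ 2 ^ (t - s))%N)) => u.
by rewrite /rckey r c.
Qed.

(* The maximizing signs can be read off the codes of the next level, so the
   refined block averages see them as well as A does. *)
Lemma cut_le_level s :
  cut_le (A - avg_mx (codes s)) (level_dist s s.+1 * (m%:R * n%:R)).
Proof.
set z := best_sign (A - avg_mx (codes s)).
suff H : `|sform (A - avg_mx (codes s)) z| <= level_dist s s.+1 * (m%:R * n%:R).
  by move=> x y x1 y1; apply: le_trans H; exact: cut_le_best.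
(* The last bit of a code is its parity, so [g] recovers the product of the two signs from the key
   of the next level. *)
pose g u : R := sgnb (odd u.1) * sgnb (odd u.2).
have gE u : sgnb (z.1 u.1) * sgnb (z.2 u.2) = g (rckey (codes s.+1) u).
  by rewrite /g /rckey /codes /= -/(codes s) -/z !oddD !odd_double !oddb.
have g1 u : `|g u| <= 1 by rewrite normrM mulr_ile1 ?sgnb_le1.
rewrite /sform bform_pair.
under eq_bigr do rewrite /= gE !mxE mulrBl.
rewrite sumrB -(bavg_orth (rckey (codes s.+1)) entry g) -sumrB.
under eq_bigr do rewrite -mulrBl.
rewrite /level_dist /adist card_prod !card_ord natrM.
have [N0|N0] := eqVneq (m%:R * n%:R : R) 0.
  have T0 : #|{: 'I_m * 'I_n}| = 0%N.
    by apply/eqP; rewrite card_prod !card_ord -(@pnatr_eq0 R) natrM N0.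
  by rewrite big1 ?normr0 ?N0 ?mulr0 // => u; have /card0_eq/(_ u) := T0.
rewrite divfK //; apply: le_trans (ler_norm_sum _ _ _) _.
by apply: ler_sum => u _; rewrite normrM ler_piMr.
Qed.

End WeakRegularity.

(** * Sorting rows or columns by code *)

Lemma sorting_perm {m : nat} (f : 'I_m -> nat) :
  exists s : 'S_m, forall i j : 'I_m, (i <= j)%N -> (f (s i) <= f (s j))%N.
Proof.
pose e := relpre f leq; pose t := sort e (enum 'I_m).
have st : size t = m by rewrite size_sort size_enum_ord.
have ut : uniq t by rewrite sort_uniq enum_uniq.
(* The index itself is the default of [nth], because ['I_m] has no fixed element when [m] is 0;
   inside the range the default can be changed freely. *)
have inj : injective (fun i : 'I_m => nth i t i).
  move=> i j; rewrite (set_nth_default i j) ?st // => /eqP.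
  by rewrite nth_uniq ?st // => /eqP/val_inj.
exists (perm inj) => i j ij; rewrite !permE (set_nth_default i j) ?st //.
have sr : sorted e t by apply: sort_sorted => x y; exact: leq_total.
apply: (sorted_leq_nth _ _ i sr) => //; rewrite ?inE ?st //.
- by move=> y x w; exact: leq_trans.
- by move=> x; exact: leqnn.
Qed.

Lemma card_ord_lt {m k : nat} : (k <= m)%N -> #|[pred i : 'I_m | (i < k)%N]| = k.
Proof.
by move=> km; rewrite -sum1_card -(big_ord_widen _ (fun=> 1%N)) // sum1_card card_ord.
Qed.

(** After sorting, the positions with value below [p] form an initial segment, whose length is the
    number of such indices. *)
Lemma lt_card_sorted {m : nat} (f : 'I_m -> nat) (s : 'S_m) p (i : 'I_m) :
  (forall i j : 'I_m, (i <= j)%N -> (f (s i) <= f (s j))%N) ->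
  (i < #|[pred i | (f i < p)%N]|)%N = (f (s i) < p)%N.
Proof.
move=> mono.
have -> : #|[pred i | (f i < p)%N]| = #|[pred i | (f (s i) < p)%N]|.
  by rewrite -!sum1_card (reindex_inj (@perm_inj _ s)).
have im := ltn_ord i.
case: (ltnP (f (s i)) p) => Hi; last apply/negbTE.
  rewrite -{1}(card_ord_lt im); apply/subset_leq_card/fintype.subsetP => j.
  by rewrite !inE ltnS => /mono/leq_ltn_trans; apply.
rewrite -leqNgt -[leqRHS](card_ord_lt (ltnW im)); apply/subset_leq_card/fintype.subsetP => j.
rewrite !inE; apply: contraTT; rewrite -!leqNgt => /mono.
exact: leq_trans.
Qed.

(** * The L1 distance on the unit square *)

Section UnitSquareDistance.
Context {R : realType}.
Notation mu := (@lebesgue_measure R).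
Notation mu2 := (mu \x mu)%E.
Implicit Types F G H : R * R -> R.

(** Half-open, so that half-open pixels tile it exactly. *)
Definition unitsq : set (R * R) := `[0, 1[ `*` `[0, 1[.

Lemma measurable_unitsq : measurable unitsq.
Proof. by apply: measurableX; exact: measurable_itv. Qed.

Lemma lebesgue_measure01 : mu `[0, 1[ = 1%E.
Proof. by rewrite lebesgue_measure_itv /= lte_fin ltr01 oppr0 adde0. Qed.

Lemma unitsq1 : mu2 unitsq = 1%E.
Proof.
rewrite product_measure1E; try exact: measurable_itv.
by rewrite /= lebesgue_measure01 mule1.
Qed.

(** Measurability and bounds are asked on the whole plane, which spares side conditions on
    domains. *)
Definition graphon_fun F := measurable_fun setT F /\ forall z, 0 <= F z <= 1.

Definition L1dist F G : \bar R := (\int[mu2]_(z in unitsq) `|F z - G z|%:E)%E.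

Lemma measurable_absB F G (D : set (R * R)) : graphon_fun F -> graphon_fun G ->
  measurable_fun D (fun z : R * R => `|F z - G z|%:E : \bar R).
Proof.
move=> [mF _] [mG _]; apply: measurable_funTS; apply/measurable_EFinP.
by apply: measurableT_comp => //; exact: measurable_funB.
Qed.

Lemma L1dist_sym F G : L1dist F G = L1dist G F.
Proof. by apply: eq_integral => z _; rewrite distrC. Qed.

Lemma L1dist_triangle F G H : graphon_fun F -> graphon_fun G -> graphon_fun H ->
  (L1dist F H <= L1dist F G + L1dist G H)%E.
Proof.
move=> gF gG gH; rewrite /L1dist -ge0_integralD //; try exact: measurable_absB;
  last exact: measurable_unitsq.
apply: ge0_le_integral => //.
- exact: measurable_unitsq.
- exact: measurable_absB.
- by apply: emeasurable_funD; exact: measurable_absB.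
- move=> z _; rewrite -EFinD lee_fin.
  by rewrite (le_trans _ (ler_normD _ _)) // addrA subrK.
Qed.

End UnitSquareDistance.

(** * Step functions and their dependence on breakpoints and values *)

Section StepFunction.
Context {R : realType}.
Notation mu := (@lebesgue_measure R).
Notation mu2 := (mu \x mu)%E.
Implicit Types (a b : nat -> R) (d : nat -> nat -> R).

(* Breakpoint 0 is omitted, so that points left of a 1 have code 0. *)
Definition step_code a (K : nat) (x : R) : nat := (\sum_(1 <= p < K) (a p <= x)%R)%N.

Definition step_fun d a b K (z : R * R) : R :=
  d (step_code a K z.1) (step_code b K z.2).

Lemma step_code_lt a K x : (0 < K)%N -> (step_code a K x < K)%N.
Proof.
move=> K0; apply: (@leq_ltn_trans (\sum_(1 <= p < K) 1)%N).
  by apply: leq_sum => p _; exact: leq_b1.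
by rewrite sum_nat_const_nat muln1; lia.
Qed.

(** Induction on the lists of breakpoints: the first one splits the plane into two half-planes, and
    its contribution to the code is absorbed as a shift of the table, hence the generalisation over
    [d']. *)
Lemma measurable_step_fun d a b K : measurable_fun setT (step_fun d a b K).
Proof.
rewrite /step_fun /step_code; set s := index_iota 1 K.
have H t d' : measurable_fun setT (fun z : R * R =>
    d' (\sum_(p <- s) (a p <= z.1)%R)%N (\sum_(q <- t) (b q <= z.2)%R)%N : R).
  elim: t d' => [|q t IHt] d'.
    elim: s d' => [|p r IHr] d'.
      under eq_fun do rewrite !big_nil.
      exact: measurable_cst.
    under eq_fun do rewrite big_cons.
    rewrite (_ : (fun _ => _) = (fun z : R * R => if a p <= z.1 then
       d' (1 + \sum_(p <- r) (a p <= z.1)%R)%N (\sum_(q <- [::]) (b q <= z.2)%R)%N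
       else d' (\sum_(p <- r) (a p <= z.1)%R)%N (\sum_(q <- [::]) (b q <= z.2)%R)%N)).
      apply: measurable_fun_ifT; first exact: measurable_fun_ler.
        exact: (IHr (fun x y => d' (1 + x)%N y)).
      exact: (IHr d').
    by apply/funext => z; case: ifP.
  under eq_fun do rewrite [X in d' _ X]big_cons.
  rewrite (_ : (fun _ => _) = (fun z : R * R => if b q <= z.2 then
     d' (\sum_(p <- s) (a p <= z.1)%R)%N (1 + \sum_(q <- t) (b q <= z.2)%R)%N
     else d' (\sum_(p <- s) (a p <= z.1)%R)%N (\sum_(q <- t) (b q <= z.2)%R)%N)).
    apply: measurable_fun_ifT; first exact: measurable_fun_ler.
      exact: (IHt (fun x y => d' x (1 + y)%N)).
    exact: (IHt d').
  by apply/funext => z; case: ifP.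
exact: H.
Qed.

Lemma graphon_step_fun d a b K : (forall p q, 0 <= d p q <= 1) ->
  graphon_fun (step_fun d a b K).
Proof. by move=> d01; split=> [|z]; [exact: measurable_step_fun|exact: d01]. Qed.

(** The points that [r] and [r'], taken as breakpoints, place on different sides. *)
Definition strip (r r' : R) : set R := `[Num.min r r', Num.max r r'[.

Lemma mem_strip r r' x : (r <= x) != (r' <= x) -> strip r r' x.
Proof.
rewrite /strip /= in_itv /= ge_min lt_max !ltNge.
by case: (r <= x); case: (r' <= x).
Qed.

Lemma strip_measure r r' : mu (strip r r') = `|r - r'|%:E.
Proof.
rewrite /strip lebesgue_measure_itv /= lte_fin.
have [rr|rr|->] := ltgtP r r'; rewrite ?ltxx ?subrr ?normr0 //=.
  by rewrite rr -EFinB distrC ger0_norm ?subr_ge0 ?ltW.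
by rewrite rr -EFinB ger0_norm ?subr_ge0 ?ltW.
Qed.

Lemma step_code_neq a a' K x : step_code a K x != step_code a' K x ->
  1 <= \sum_(1 <= p < K) \1_(strip (a p) (a' p)) x :> R.
Proof.
move=> ne; have [/hasP[p pK ap]|/hasPn H] :=
    boolP (has (fun p => (a p <= x) != (a' p <= x)) (index_iota 1 K)); last first.
  move/eqP: ne; case; apply: eq_big_seq => p pK.
  by have := H p pK; rewrite negbK => /eqP ->.
rewrite (bigD1_seq p) ?iota_uniq //= indicE mem_set; last exact: mem_strip.
by rewrite lerDl sumr_ge0 // => q _; rewrite indicE.
Qed.

(** Where both codes agree, the difference is a single term of the double sum. Elsewhere some strip
    contains a coordinate of [z], so the strip indicators already sum to 1, which bounds any
    difference of values in the unit interval. *)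
Lemma step_fun_dist d d' a a' b b' K z : (0 < K)%N ->
  (forall p q, 0 <= d p q <= 1) -> (forall p q, 0 <= d' p q <= 1) ->
  `|step_fun d a b K z - step_fun d' a' b' K z| <=
  \sum_(p < K) \sum_(q < K) `|d p q - d' p q| +
  (\sum_(1 <= p < K) \1_(strip (a p) (a' p)) z.1 +
   \sum_(1 <= q < K) \1_(strip (b q) (b' q)) z.2).
Proof.
move=> K0 d01 d'01.
have D0 : 0 <= \sum_(p < K) \sum_(q < K) `|d p q - d' p q|.
  by apply: sumr_ge0 => p _; apply: sumr_ge0.
have S0 c c' x : 0 <= \sum_(1 <= p < K) \1_(strip (c p) (c' p)) x :> R.
  by apply: sumr_ge0 => p _; rewrite indicE.
have le1 : `|step_fun d a b K z - step_fun d' a' b' K z| <= 1.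
  rewrite /step_fun.
  move: (d01 (step_code a K z.1) (step_code b K z.2))
        (d'01 (step_code a' K z.1) (step_code b' K z.2)).
  by rewrite ler_norml => /andP[? ?] /andP[? ?]; apply/andP; split; lra.
have [Ea|/step_code_neq Ha] := eqVneq (step_code a K z.1) (step_code a' K z.1); last first.
  by have := S0 b b' z.2; lra.
have [Eb|/step_code_neq Hb] := eqVneq (step_code b K z.2) (step_code b' K z.2); last first.
  by have := S0 a a' z.1; lra.
apply: (@le_trans _ _ (\sum_(p < K) \sum_(q < K) `|d p q - d' p q|)); last first.
  by rewrite lerDl addr_ge0.
rewrite /step_fun Ea Eb.
rewrite (bigD1 (Ordinal (step_code_lt a' K z.1 K0))) //=.
rewrite (bigD1 (Ordinal (step_code_lt b' K z.2 K0))) //=.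
rewrite -addrA lerDl addr_ge0 ?sumr_ge0 // => p _; exact: sumr_ge0.
Qed.

(** Only an inequality, because the strip may stick out of the unit interval. *)
Lemma integral_strip_l r r' :
  (\int[mu2]_(z in unitsq) (\1_(strip r r') z.1)%:E <= `|r - r'|%:E)%E.
Proof.
pose S : set (R * R) := strip r r' `*` `[0, 1[.
have mS : measurable S by apply: measurableX; exact: measurable_itv.
have -> : (\int[mu2]_(z in unitsq) (\1_(strip r r') z.1)%:E =
    \int[mu2]_(z in unitsq) (\1_S z : R)%:E)%E.
  apply: eq_integral => z /set_mem[_ z2]; rewrite !indicE; congr ((_ : bool)%:R%:E).
  by apply/idP/idP => /set_mem H; apply/mem_set; [split|case: H].
rewrite integral_indic //; last exact: measurable_unitsq.
apply: (@le_trans _ _ (mu2 S)).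
  apply: le_measure; rewrite ?inE //.
  by apply: measurableI => //; exact: measurable_unitsq.
rewrite product_measure1E; try exact: measurable_itv.
by rewrite /= strip_measure lebesgue_measure01 mule1.
Qed.

Lemma integral_strip_r r r' :
  (\int[mu2]_(z in unitsq) (\1_(strip r r') z.2)%:E <= `|r - r'|%:E)%E.
Proof.
pose S : set (R * R) := `[0, 1[ `*` strip r r'.
have mS : measurable S by apply: measurableX; exact: measurable_itv.
have -> : (\int[mu2]_(z in unitsq) (\1_(strip r r') z.2)%:E =
    \int[mu2]_(z in unitsq) (\1_S z : R)%:E)%E.
  apply: eq_integral => z /set_mem[z1 _]; rewrite !indicE; congr ((_ : bool)%:R%:E).
  by apply/idP/idP => /set_mem H; apply/mem_set; [split|case: H].
rewrite integral_indic //; last exact: measurable_unitsq.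
apply: (@le_trans _ _ (mu2 S)).
  apply: le_measure; rewrite ?inE //.
  by apply: measurableI => //; exact: measurable_unitsq.
rewrite product_measure1E; try exact: measurable_itv.
by rewrite /= strip_measure lebesgue_measure01 mul1e.
Qed.

Lemma L1dist_step_fun d d' a a' b b' K : (0 < K)%N ->
  (forall p q, 0 <= d p q <= 1) -> (forall p q, 0 <= d' p q <= 1) ->
  (L1dist (step_fun d a b K) (step_fun d' a' b' K) <=
  (\sum_(p < K) \sum_(q < K) `|d p q - d' p q| +
   (\sum_(1 <= p < K) `|a p - a' p| + \sum_(1 <= q < K) `|b q - b' q|))%:E)%E.
Proof.
move=> K0 d01 d'01; set D := \sum_(p < K) _.
have D0 : 0 <= D by apply: sumr_ge0 => p _; apply: sumr_ge0.
have mU := @measurable_unitsq R.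
have m1 r r' : measurable_fun unitsq (fun z : R * R => (\1_(strip r r') z.1 : R)%:E).
  apply: measurable_funTS; apply/measurable_EFinP.
  by apply: measurableT_comp => //; apply: measurable_indic; exact: measurable_itv.
have m2 r r' : measurable_fun unitsq (fun z : R * R => (\1_(strip r r') z.2 : R)%:E).
  apply: measurable_funTS; apply/measurable_EFinP.
  by apply: measurableT_comp => //; apply: measurable_indic; exact: measurable_itv.
have P1 z c c' : (0 <= \sum_(1 <= p < K) (\1_(strip (c p) (c' p)) z : R)%:E)%E.
  by apply: sume_ge0 => p _; rewrite lee_fin indicE.
have M1 c c' : measurable_fun unitsq (fun z : R * R =>
    \sum_(1 <= p < K) (\1_(strip (c p) (c' p)) z.1 : R)%:E)%E.
  by apply: emeasurable_sum => p; exact: m1.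
have M2 c c' : measurable_fun unitsq (fun z : R * R =>
    \sum_(1 <= p < K) (\1_(strip (c p) (c' p)) z.2 : R)%:E)%E.
  by apply: emeasurable_sum => p; exact: m2.
apply: (@le_trans _ _ (\int[mu2]_(z in unitsq) (D%:E +
   (\sum_(1 <= p < K) (\1_(strip (a p) (a' p)) z.1)%:E +
    \sum_(1 <= q < K) (\1_(strip (b q) (b' q)) z.2)%:E)))%E).
  apply: ge0_le_integral => //.
  - by apply: measurable_absB; exact: graphon_step_fun.
  - apply: emeasurable_funD; first exact: measurable_cst.
    by apply: emeasurable_funD; [exact: M1|exact: M2].
  - by move=> z _; rewrite !sumEFin -!EFinD lee_fin; exact: step_fun_dist.
rewrite ge0_integralD //; last 2 first.
- by move=> z _; rewrite adde_ge0.
- by apply: emeasurable_funD; [exact: M1|exact: M2].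
rewrite integral_cst // [X in (_ * X)%E]unitsq1 mule1 EFinD leeD2l //.
rewrite ge0_integralD //; [|exact: M1|exact: M2].
rewrite [leRHS]EFinD; apply: leeD.
  rewrite -sumEFin ge0_integral_sum //; last by move=> p; exact: m1.
  by apply: lee_sum => p _; exact: integral_strip_l.
rewrite -sumEFin ge0_integral_sum //; last by move=> p; exact: m2.
by apply: lee_sum => p _; exact: integral_strip_r.
Qed.

End StepFunction.

(** * The pixel grid and discrete approximations *)

Section Pixels.
Context {R : realType} {m n : nat}.
Notation mu := (@lebesgue_measure R).
Notation mu2 := (mu \x mu)%E.
Implicit Types F G : R * R -> R.
Hypotheses (m0 : (0 < m)%N) (n0 : (0 < n)%N).

Definition cell (k i : nat) : set R := `[i%:R / k%:R, i.+1%:R / k%:R[.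

Definition pixel (u : 'I_m * 'I_n) : set (R * R) := cell m u.1 `*` cell n u.2.

Lemma measurable_cell k i : measurable (cell k i).
Proof. exact: measurable_itv. Qed.

Lemma measurable_pixel u : measurable (pixel u).
Proof. by apply: measurableX; exact: measurable_cell. Qed.

Lemma cell_measure k i : (0 < k)%N -> mu (cell k i) = (k%:R^-1)%:E.
Proof.
move=> k0; rewrite lebesgue_measure_itv /= lte_fin ltr_pM2r ?invr_gt0 ?ltr0n //.
by rewrite ltr_nat ltnSn -EFinB -mulrBl -natrB // subSnn mul1r.
Qed.

Lemma pixel_measure u : mu2 (pixel u) = ((m%:R * n%:R)^-1)%:E.
Proof.
rewrite product_measure1E; try exact: measurable_cell.
by rewrite /= !cell_measure // -EFinM invfM.
Qed.

Lemma cell_inj k i j x : (0 < k)%N -> cell k i x -> cell k j x -> i = j.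
Proof.
have H i' j' : (0 < k)%N -> cell k i' x -> cell k j' x -> (i' <= j')%N.
  move=> k0; rewrite /cell /= !in_itv /= => /andP[xi _] /andP[_ xj].
  have := le_lt_trans xi xj.
  by rewrite ltr_pM2r ?invr_gt0 ?ltr0n // ltr_nat ltnS.
by move=> k0 xi xj; apply/eqP; rewrite eqn_leq; apply/andP; split; exact: H.
Qed.

Lemma cell_exists k x : (0 < k)%N -> `[0, 1[%classic x -> exists i : 'I_k, cell k i x.
Proof.
move=> k0; rewrite /= in_itv /= => /andP[x0 x1].
have kR : (0 : R) < k%:R by rewrite ltr0n.
have := @truncn_itv R (x * k%:R); rewrite mulr_ge0 // => /(_ isT)/andP[l r].
have tk : (Num.truncn (x * k%:R)%R < k)%N.
  by rewrite -(ltr_nat R); apply: le_lt_trans l _; rewrite gtr_pMl.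
exists (Ordinal tk); rewrite /cell /= in_itv /=.
by rewrite ler_pdivrMr // l ltr_pdivlMr.
Qed.

Lemma cell_sub k (i : 'I_k) x : cell k i x -> `[0, 1[%classic x.
Proof.
have k0 : (0 < k)%N by exact: leq_ltn_trans (ltn_ord i).
rewrite /cell /= !in_itv /= => /andP[l r]; rewrite (le_trans _ l) //=.
apply: lt_le_trans r _; rewrite ler_pdivrMr ?ltr0n // mul1r ler_nat.
exact: ltn_ord.
Qed.

Lemma unitsq_pixels : unitsq = \big[setU/set0]_(u : 'I_m * 'I_n) pixel u.
Proof.
rewrite -bigcup_seq; apply/seteqP; split=> [z [z1 z2]|z [u _ [u1 u2]]].
  have [i zi] := cell_exists _ _ m0 z1; have [j zj] := cell_exists _ _ n0 z2.
  by exists (i, j) => //=; rewrite mem_index_enum.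
by split; [exact: cell_sub u1|exact: cell_sub u2].
Qed.

Lemma L1dist_pixels F G : graphon_fun F -> graphon_fun G ->
  (L1dist F G = \sum_u \int[mu2]_(z in pixel u) `|F z - G z|%:E)%E.
Proof.
move=> gF gG; rewrite /L1dist unitsq_pixels ge0_integral_bigsetU //.
- exact: measurable_pixel.
- exact: index_enum_uniq.
- move=> [i j] [i' j'] _ _ [z [[z1 z2] [z3 z4]]].
  by congr pair; apply/val_inj; [exact: cell_inj m0 z1 z3|exact: cell_inj n0 z2 z4].
- exact: measurable_absB.
Qed.

Lemma integrable_pixel F u : graphon_fun F -> mu2.-integrable (pixel u) (EFin \o F).
Proof.
move=> [mF F01]; apply: measurable_bounded_integrable.
- exact: measurable_pixel.
- by rewrite [X in (X < _)%E]pixel_measure ltry.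
- exact: measurable_funTS.
- exists 1; split; first exact: num_real.
  move=> M M1 z _ /=; have /andP[? ?] := F01 z.
  by rewrite ger0_norm // (le_trans _ (ltW M1)).
Qed.

Lemma integrable_cell (f : R -> R) k i : (0 < k)%N ->
  measurable_fun setT f -> (forall x, 0 <= f x <= 1) ->
  mu.-integrable (cell k i) (EFin \o f).
Proof.
move=> k0 mf f01; apply: measurable_bounded_integrable.
- exact: measurable_cell.
- by rewrite [X in (X < _)%E](cell_measure k i k0) ltry.
- exact: measurable_funTS.
- exists 1; split; first exact: num_real.
  move=> M M1 z _ /=; have /andP[? ?] := f01 z.
  by rewrite ger0_norm // (le_trans _ (ltW M1)).
Qed.

(* Half-open and closed intervals carry the same integrals, and Tonelli turns
   the iterated integral into an integral over the pixel. *)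
Lemma discr_approxE F u : graphon_fun F ->
  discr_approx m n F u.1 u.2 =
  m%:R * n%:R * Rintegral mu2 (pixel u) F.
Proof.
move=> [mF F01]; rewrite mxE; congr (_ * _).
(* Extending [F] by 0 outside the pixel allows Tonelli on the whole plane. *)
pose h z : \bar R := ((EFin \o F) \_ (pixel u)) z.
have mh : measurable_fun setT h.
  apply/(measurable_restrictT _ _).1; first exact: measurable_pixel.
  by apply: measurable_funTS; exact/measurable_EFinP.
have h0 z : (0 <= h z)%E.
  rewrite /h patchE; case: ifP => // _; rewrite lee_fin.
  by case/andP: (F01 z).
have mFx x : measurable_fun setT (fun y => F (x, y)).
  by apply: measurableT_comp => //; exact: measurable_pair1.
have inner x : (Rintegral mu `[u.2%:R / n%:R, u.2.+1%:R / n%:R] (fun y => F (x, y)))%:E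
    = (\int[mu]_(y in cell n u.2) (F (x, y))%:E)%E.
  have iFx : mu.-integrable (cell n u.2) (EFin \o (fun y => F (x, y))).
    exact: integrable_cell.
  rewrite -Rintegral_itv_bndo_bndc // /Rintegral fineK //.
  by apply: integrable_fin_num => //; exact: measurable_cell.
have hE x : cell m u.1 x -> (fubini_F mu h x = \int[mu]_(y in cell n u.2) (F (x, y))%:E)%E.
  move=> xm; rewrite [RHS]integral_mkcond /fubini_F; apply: eq_integral => y _.
  rewrite /h !patchE; congr (if _ then _ else _).
  by apply/idP/idP => /set_mem H; apply/mem_set; [case: H|split].
have hE0 x : ~ cell m u.1 x -> fubini_F mu h x = 0%E.
  move=> xm; rewrite /fubini_F integral0_eq // => y _.
  by rewrite /h patchE memNset // => -[].
rewrite /Rintegral; congr fine.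
pose I : set R := `[(u.1%:R / m%:R : R), (u.1.+1%:R / m%:R : R)]%classic.
transitivity (\int[mu]_(x in I) \int[mu]_(y in cell n u.2) (F (x, y))%:E)%E.
  by apply: eq_integral => x _; exact: inner.
(* Dropping the right endpoint requires measurability of the inner integral, which is inherited from
   [fubini_F mu h], equal to it on the cell. *)
rewrite -integral_itv_bndo_bndc; last first.
  apply: (@eq_measurable_fun _ _ _ _ _ (fubini_F mu h)) => [x /set_mem xm|].
    exact: hE.
  by apply: measurable_funTS; exact: measurable_fun_fubini_tonelli_F.
rewrite [RHS]integral_mkcond.
apply: etrans (esym (@fubini_tonelli1 _ _ _ _ R mu mu h mh h0)).
rewrite integral_mkcond.
apply: eq_integral => x _; rewrite patchE.
case: ifPn => [/set_mem xm|/negP xm]; first exact/esym/hE.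
by apply/esym/hE0 => H; apply: xm; exact: mem_set.
Qed.

Lemma discr_approx_const F u r : graphon_fun F -> (forall z, pixel u z -> F z = r) ->
  discr_approx m n F u.1 u.2 = r.
Proof.
move=> gF Fr; rewrite discr_approxE //.
have mn0 : m%:R * n%:R != 0 :> R by rewrite mulf_neq0 // pnatr_eq0 -lt0n.
rewrite /Rintegral (_ : (\int[mu2]_(z in _) _)%E = (\int[mu2]_(z in pixel u) r%:E)%E).
  rewrite integral_cst; last exact: measurable_pixel.
  by rewrite [X in (_ * X)%E]pixel_measure -EFinM /= mulrCA divff // mulr1.
by apply: eq_integral => z /set_mem/Fr ->.
Qed.

(** Averaging over pixels contracts the L1 distance: on each pixel the absolute value of the
    integral is at most the integral of the absolute value. *)
Lemma sum_discr_approx_le F G : graphon_fun F -> graphon_fun G ->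
  ((\sum_u `|discr_approx m n F u.1 u.2 - discr_approx m n G u.1 u.2|)%:E
   <= (m%:R * n%:R)%:E * L1dist F G)%E.
Proof.
move=> gF gG; rewrite L1dist_pixels // ge0_sume_distrr; last first.
  by move=> u _; apply: integral_ge0 => z _; rewrite lee_fin.
rewrite -sumEFin; apply: lee_sum => u _.
have iF := integrable_pixel F u gF; have iG := integrable_pixel G u gG.
rewrite !discr_approxE // -mulrBr normrM (ger0_norm (mulr_ge0 _ _)) //.
rewrite -RintegralB //; last exact: measurable_pixel.
rewrite [leLHS]EFinM lee_pmul2l // ?lte_fin ?mulr_gt0 ?ltr0n //.
have iB : mu2.-integrable (pixel u) (EFin \o (fun z => F z - G z)).
  apply: (@integrableB _ _ _ mu2 _ _ (EFin \o F) (EFin \o G)) => //.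
  exact: measurable_pixel.
apply: le_trans (_ : (`|Rintegral mu2 (pixel u) (fun z => F z - G z)|%:E <=
   (Rintegral mu2 (pixel u) (fun z => `|F z - G z|))%:E)%E) _.
  by rewrite lee_fin le_normr_Rintegral //; exact: measurable_pixel.
rewrite /Rintegral fineK //; apply: integrable_fin_num; first exact: measurable_pixel.
exact: integrable_norm iB.
Qed.

Lemma L1dist_const_le F G (f g : 'I_m * 'I_n -> R) :
  graphon_fun F -> graphon_fun G ->
  (forall u z, pixel u z -> F z = f u) -> (forall u z, pixel u z -> G z = g u) ->
  (L1dist F G = ((\sum_u `|f u - g u|) / (m%:R * n%:R))%:E)%E.
Proof.
move=> gF gG Ff Gg; rewrite L1dist_pixels // mulr_suml -sumEFin.
apply: eq_bigr => u _.
rewrite (_ : (\int[mu2]_(z in _) _)%E = (\int[mu2]_(z in pixel u) `|f u - g u|%:E)%E).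
  rewrite integral_cst; last exact: measurable_pixel.
  by rewrite [X in (_ * X)%E]pixel_measure.
by apply: eq_integral => z /set_mem zu; rewrite (Ff u) // (Gg u).
Qed.

Lemma cut_le_discr_approx F G e : graphon_fun F -> graphon_fun G ->
  (L1dist F G <= e%:E)%E ->
  cut_le (discr_approx m n F - discr_approx m n G) (e * (m%:R * n%:R)).
Proof.
move=> gF gG FGe x y x1 y1; apply: le_trans (cut_le_sum _ x y x1 y1) _.
under eq_bigr => u _ do rewrite entry_subE.
rewrite -lee_fin; apply: le_trans (sum_discr_approx_le _ _ gF gG) _.
by rewrite [leRHS]EFinM muleC lee_wpmul2r // lee_fin mulr_ge0.
Qed.

End Pixels.

(** A point of cell [i] is to the right of breakpoint [p] iff at most [i] indices have code below
    [p], which after sorting means [p <= f (s i)]. Exactly [f (s i)] values of [p] from 1 on satisfy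
    this, all of them below [K]. *)
Lemma step_code_sorted {R : realType} {m : nat} (f : 'I_m -> nat) (s : 'S_m)
    (K : nat) (i : 'I_m) (x : R) :
  (forall i, f i < K)%N ->
  (forall i j : 'I_m, (i <= j)%N -> (f (s i) <= f (s j))%N) ->
  cell m i x ->
  step_code (fun p => #|[pred i | (f i < p)%N]|%:R / m%:R) K x = f (s i).
Proof.
move=> fK mono; rewrite /cell /= in_itv /= => /andP[l r].
have m0 : (0 : R) < m%:R by rewrite ltr0n (leq_ltn_trans _ (ltn_ord i)).
have E p : (#|[pred i | (f i < p)%N]|%:R / m%:R <= x :> R) = (p <= f (s i))%N.
  have H := lt_card_sorted f s p i mono.
  rewrite leqNgt -H -leqNgt; apply/idP/idP.
    apply: contraTT; rewrite -ltnNge -ltNge => ic.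
    by apply: lt_le_trans r _; rewrite ler_pM2r ?invr_gt0 // ler_nat.
  by move=> ci; apply: le_trans l; rewrite ler_pM2r ?invr_gt0 // ler_nat.
rewrite /step_code; under eq_bigr do rewrite E.
rewrite (big_cat_nat (n := (f (s i)).+1)) //=.
rewrite (eq_big_nat _ _ (F2 := fun=> 1%N)) => [|p /andP[_ pf]]; last by rewrite -ltnS pf.
rewrite [X in (_ + X)%N](eq_big_nat _ _ (F2 := fun=> 0%N)) => [|p /andP[pf _]]; last first.
  by rewrite leqNgt pf.
by rewrite !sum_nat_const_nat muln1 muln0 addn0 subn1.
Qed.

(** * Upper limits of L1-summable sequences of graphons *)

Section LimSup.
Context {R : realType}.
Notation mu := (@lebesgue_measure R).
Notation mu2 := (mu \x mu)%E.

Lemma limn_sup_itv (u : R^nat) (N : nat) (c d : R) :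
  (forall n, 0 <= u n <= 1) -> (forall n, (N <= n)%N -> c <= u n <= d) ->
  c <= limn_sup u <= d.
Proof.
move=> u01 ucd.
have bu : bounded_fun u.
  exists 1; split; first exact: num_real.
  move=> M M1 n _; have /andP[? ?] := u01 n.
  by rewrite /= ger0_norm // (le_trans _ (ltW M1)).
have ubu : has_ubound (range u) by exists 1 => _ [n _ <-]; case/andP: (u01 n).
(* Boundedness identifies the upper limit with the infimum of the tail suprema. *)
rewrite limn_supE //; apply/andP; split.
  apply: lb_le_inf; first by exists (sups u 0%N), 0%N.
  move=> _ [k _ <-]; apply: (@le_trans _ _ (u (maxn k N))).
    by case/andP: (ucd (maxn k N) (leq_maxr _ _)).
  apply: ub_le_sup; first exact: has_ubound_sdrop.
  by exists (maxn k N) => //=; exact: leq_maxl.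
apply: (@le_trans _ _ (sups u N)).
  by apply: ge_inf; [exact: bounded_fun_has_lbound_sups|exists N].
apply: ge_sup; first by exists (u N), N => /=.
by move=> _ [n /= Nn <-]; case/andP: (ucd n Nn).
Qed.

Variable G : nat -> R * R -> R.
Hypothesis gG : forall j, graphon_fun (G j).

Let W z := limn_sup (G ^~ z).

Lemma graphon_limn_sup : graphon_fun W.
Proof.
have G01 z j : 0 <= G j z <= 1 by exact: (gG j).2.
split=> [|z]; last exact: (limn_sup_itv _ 0%N).
apply: measurable_fun_limn_sup => [z _|z _|j].
- by exists 1 => _ [j _ <-]; case/andP: (G01 z j).
- by exists 0 => _ [j _ <-]; case/andP: (G01 z j).
- exact: (gG j).1.
Qed.

(** By telescoping, all [G n z] with [l <= n] lie within the sum of the series of [G l z], and so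
    does their upper limit. An infinite sum leaves nothing to prove. *)
Lemma normr_sub_limn_sup l z :
  (`|G l z - W z|%:E <= \sum_(j <oo) `|G (l + j)%N z - G (l + j).+1 z|%:E)%E.
Proof.
set S := (\sum_(j <oo) _)%E.
have part k : ((\sum_(j < k) `|G (l + j)%N z - G (l + j).+1 z|)%:E <= S)%E.
  rewrite -sumEFin -(big_mkord predT (fun j => `|G (l + j)%N z - G (l + j).+1 z|%:E)).
  by apply: nneseries_lim_ge => j _ _; rewrite lee_fin.
have tele k : `|G l z - G (l + k)%N z| <=
    \sum_(j < k) `|G (l + j)%N z - G (l + j).+1 z|.
  elim: k => [|k IH]; first by rewrite addn0 subrr normr0 big_ord0.
  rewrite big_ord_recr /= addnS; apply: le_trans (lerD IH (lexx _)).
  by rewrite (le_trans _ (ler_normD _ _)) // addrA subrK.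
case ES : S => [r| |]; last 2 first.
- by rewrite leey.
- by have := part 0%N; rewrite ES big_ord0.
have /andP[cl cr] : G l z - r <= W z <= G l z + r.
  apply: (limn_sup_itv _ l) => [n|n ln]; first exact: (gG n).2.
  have := tele (n - l)%N; rewrite subnKC // => T.
  have := part (n - l)%N; rewrite ES lee_fin => /(le_trans T).
  by rewrite ler_norml => /andP[? ?]; apply/andP; split; lra.
by rewrite lee_fin ler_norml; apply/andP; split; lra.
Qed.

(** The pointwise bound is integrated term by term; the geometric tail starting at [l] sums to
    [2 * 2^-1 ^+ l]. *)
Lemma L1dist_limn_sup l : (forall j, (L1dist (G j) (G j.+1) <= (2^-1 ^+ j)%:E)%E) ->
  (L1dist (G l) W <= (2 * 2^-1 ^+ l)%:E)%E.
Proof.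
move=> GG; have gW := graphon_limn_sup.
pose h j z : \bar R := `|G (l + j)%N z - G (l + j).+1 z|%:E.
have mh j : measurable_fun unitsq (h j) by exact: measurable_absB.
have h0 j z : unitsq z -> (0 <= h j z)%E by move=> _; rewrite lee_fin.
have mU := @measurable_unitsq R.
apply: (@le_trans _ _ (\int[mu2]_(z in unitsq) \sum_(j <oo) h j z)%E).
  apply: ge0_le_integral => //.
  - exact: measurable_absB.
  - by apply: ge0_emeasurable_sum => [j z Uz _|j _]; [exact: h0|exact: mh].
  - by move=> z _; exact: normr_sub_limn_sup.
rewrite integral_nneseries //.
apply: lime_le.
  by apply: is_cvg_nneseries => j _ _; apply: integral_ge0 => z; exact: h0.
apply: nearW => k; rewrite big_mkord.
apply: (@le_trans _ _ (\sum_(j < k) (2^-1 ^+ (l + j))%:E)%E).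
  by apply: lee_sum => j _; exact: GG.
rewrite sumEFin lee_fin.
have -> : \sum_(j < k) 2^-1 ^+ (l + j) = 2 * 2^-1 ^+ l - 2 * 2^-1 ^+ (l + k) :> R.
  elim: k => [|k IH]; first by rewrite big_ord0 addn0 subrr.
  by rewrite big_ord_recr /= IH addnS exprS; field.
by rewrite lerBlDr lerDl mulr_ge0 // exprn_ge0 // invr_ge0.
Qed.

End LimSup.

(** * Block averages as step functions on the unit square *)

Section BlockGraphon.
Context {R : realType} {m n : nat}.
Variable A : 'M[R]_(m, n).
Hypothesis A01 : forall i j, 0 <= A i j <= 1.
Hypotheses (m0 : (0 < m)%N) (n0 : (0 < n)%N).

(** The breakpoints after sorting: class [p] occupies the interval from [cumfreq k f p] to
    [cumfreq k f p.+1]. *)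
Definition cumfreq (k : nat) (f : 'I_k -> nat) (p : nat) : R :=
  #|[pred i | (f i < p)%N]|%:R / k%:R.

Lemma cumfreq_itv k (f : 'I_k -> nat) p : 0 <= cumfreq k f p <= 1.
Proof.
rewrite /cumfreq divr_ge0 //=; have [k0|k0] := posnP k.
  by rewrite (_ : k%:R = 0) ?invr0 ?mulr0 // k0.
rewrite ler_pdivrMr ?ltr0n // mul1r ler_nat -[leqRHS]card_ord.
exact: max_card.
Qed.

Definition block_val s p q := bavg (rckey (codes A s)) (entry A) (p, q).

Lemma entry_itv u : 0 <= entry A u <= 1.
Proof. exact: A01. Qed.

Lemma block_val_itv s p q : 0 <= block_val s p q <= 1.
Proof. by apply: bavg_itv; exact: entry_itv. Qed.

Definition block_graphon s : R * R -> R :=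
  step_fun (block_val s) (cumfreq m (codes A s).1) (cumfreq n (codes A s).2) (2 ^ s).

Lemma graphon_block_graphon s : graphon_fun (block_graphon s).
Proof. by apply: graphon_step_fun; exact: block_val_itv. Qed.

Definition sorts t (sg : 'S_m * 'S_n) :=
  (forall i j : 'I_m, (i <= j)%N -> ((codes A t).1 (sg.1 i) <= (codes A t).1 (sg.1 j))%N) /\
  (forall i j : 'I_n, (i <= j)%N -> ((codes A t).2 (sg.2 i) <= (codes A t).2 (sg.2 j))%N).

Lemma sorts_exists t : exists sg, sorts t sg.
Proof.
have [s1 H1] := sorting_perm (codes A t).1.
by have [s2 H2] := sorting_perm (codes A t).2; exists (s1, s2).
Qed.

(** Coarse codes are quotients of fine ones, and division is monotone. *)
Lemma sorts_le s t sg : (s <= t)%N -> sorts t sg -> sorts s sg.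
Proof.
move=> st [H1 H2]; have [r c] := codes_div A s (t - s); rewrite subnK // in r c.
by split=> i j ij; rewrite ?r ?c leq_div2r // ?H1 ?H2.
Qed.

Lemma block_graphon_pixel s sg u z : sorts s sg -> pixel u z ->
  block_graphon s z = avg_mx A (codes A s) (sg.1 u.1) (sg.2 u.2).
Proof.
move=> [H1 H2] [z1 z2]; have [lt1 lt2] := codes_lt A s.
rewrite /block_graphon /step_fun mxE /block_val.
rewrite (step_code_sorted _ _ _ _ _ lt1 H1 z1).
by rewrite (step_code_sorted _ _ _ _ _ lt2 H2 z2).
Qed.

(** One permutation pair sorting the finer level sorts both, so both step functions are constant on
    each pixel; reindexing the sum undoes the permutations. *)
Lemma L1dist_block_graphon s t :
  L1dist (block_graphon s) (block_graphon t) = (level_dist A s t)%:E.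
Proof.
wlog st : s t / (s <= t)%N.
  move=> H; have [/H //|ts] := leqP s t.
  by rewrite L1dist_sym level_distC H // ltnW.
have [sg Ht] := sorts_exists t; have Hs := sorts_le _ _ _ st Ht.
pose b r u := avg_mx A (codes A r) (sg.1 u.1) (sg.2 u.2).
rewrite (L1dist_const_le m0 n0 _ _ (b s) (b t)); last 4 first.
- exact: graphon_block_graphon.
- exact: graphon_block_graphon.
- by move=> u z; exact: block_graphon_pixel.
- by move=> u z; exact: block_graphon_pixel.
rewrite /level_dist /adist card_prod !card_ord natrM; congr ((_ / _)%:E).
pose h (u : 'I_m * 'I_n) := (sg.1 u.1, sg.2 u.2).
have inj_h : injective h.
  by move=> [i j] [i' j'] [] /perm_inj -> /perm_inj ->.
rewrite [RHS](reindex_inj inj_h); apply: eq_bigr => u _.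
by rewrite /b !mxE distrC.
Qed.

(** The discretised block graphon is exactly the sorted average matrix. The error thus splits into
    the sorted regularity error, bounded by [cut_le_level], and a discretised difference bounded in
    L1. *)
Lemma delta_box_W_le s G e : graphon_fun G ->
  (L1dist (block_graphon s) G <= e%:E)%E ->
  delta_box_W A G <= level_dist A s s.+1 + e.
Proof.
move=> gG Ge; have [sg Hs] := sorts_exists s.
have mn0 : m%:R * n%:R != 0 :> R by rewrite mulf_neq0 // pnatr_eq0 -lt0n.
have H : cut_le (perm_rc A sg.1 sg.2 - discr_approx m n G)
    (level_dist A s s.+1 * (m%:R * n%:R) + e * (m%:R * n%:R)).
  have -> : perm_rc A sg.1 sg.2 - discr_approx m n G =
      perm_rc (A - avg_mx A (codes A s)) sg.1 sg.2 +
      (discr_approx m n (block_graphon s) - discr_approx m n G).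
    apply/matrixP => i j.
    have E : discr_approx m n (block_graphon s) i j =
        avg_mx A (codes A s) (sg.1 i) (sg.2 j).
      apply: (discr_approx_const m0 n0 _ (i, j)); first exact: graphon_block_graphon.
      by move=> z; exact: block_graphon_pixel.
    rewrite [RHS]mxE !entry_subE E [perm_rc A _ _ _ _]mxE.
    by rewrite [perm_rc _ _ _ _ _]mxE entry_subE; ring.
  apply: cut_leD; first by apply: cut_le_perm; exact: cut_le_level.
  exact: (cut_le_discr_approx m0 n0 _ _ _ (graphon_block_graphon s) gG Ge).
apply: le_trans (delta_box_le _ _ _ _ _ H) _.
by rewrite -mulrDl mulfK.
Qed.

End BlockGraphon.

(** * Limits along an ultrafilter, and extraction of a subsequence *)

Section UltraLimits.
Context {R : realType} (U : set_system nat).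
Context {UU : UltraFilter U}.

Definition Ulimit (u : nat -> R) (l : R) : Prop :=
  0 <= l <= 1 /\ forall e, 0 < e -> U [set k | `|u k - l| <= e].

(** Compactness gives a cluster point. The ultrafilter contains either the set of indices close to
    it or the complement, and the latter contradicts clustering. *)
Lemma ultra_limit (u : nat -> R) : (forall k, 0 <= u k <= 1) ->
  exists l, Ulimit u l.
Proof.
move=> u01; have uI : (u @ U) (`[0 : R, 1]%classic : set R).
  by apply: (@filterE _ U) => k /=; rewrite in_itv /=; exact: u01.
have [l [l01 cl]] := @segment_compact R 0 1 (u @ U) _ uI.
exists l; split=> [|e e0]; first by move: l01; rewrite /= in_itv.
have [//|far] := in_ultra_setVsetC [set k | `|u k - l| <= e] UU.
have uN : (u @ U) [set x | ~ `|x - l| <= e] by [].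
have [x [/= xN xl]] := cl _ _ uN (nbhsx_ballx l e e0).
by case: xN; rewrite distrC ltW.
Qed.

Definition usmall (f : nat -> R) := forall e, 0 < e -> U [set k | f k <= e].

Lemma usmallD f g : usmall f -> usmall g -> usmall (fun k => f k + g k).
Proof.
move=> sf sg e e0; have e2 : 0 < e / 2 by rewrite divr_gt0.
apply: filterS2 (sf _ e2) (sg _ e2) => k /= fk gk.
by rewrite (splitr e) lerD.
Qed.

Lemma usmall_sum (I : Type) (r : seq I) (f : I -> nat -> R) :
  (forall i, usmall (f i)) -> usmall (fun k => \sum_(i <- r) f i k).
Proof.
move=> sf; elim: r => [|i r IH].
  by move=> e e0; apply: filterE => k /=; rewrite big_nil ltW.
move=> e e0; apply: filterS (usmallD _ _ (sf i) IH e e0) => k /=.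
by rewrite big_cons.
Qed.

End UltraLimits.

Lemma subsequence_cvg0 {R : realType} (u : nat -> R) :
  (forall k, 0 <= u k) ->
  (forall e N, 0 < e -> exists2 k, (N <= k)%N & u k <= e) ->
  exists phi : nat -> nat, (forall l, (phi l < phi l.+1)%N) /\
    (fun l => u (phi l)) @ \oo --> (0 : R).
Proof.
move=> u0 small.
have /choice[f Hf] : forall lN : nat * nat,
    exists k, (lN.2 <= k)%N /\ u k <= lN.1.+1%:R^-1.
  by move=> [l N]; have [k] := small (l.+1%:R^-1) N ltac:(by rewrite invr_gt0); exists k.
(* [f (l, N)] is an index from [N] on with value at most [1 / (l + 1)]; asking for an index beyond
   the previous one makes [phi] increase strictly. *)
pose fix phi l := if l is l'.+1 then f (l, (phi l').+1) else f (0%N, 0%N).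
exists phi; split=> [l|]; first by case: (Hf (l.+1, (phi l).+1)).
apply: (@squeeze_cvgr _ _ _ _ (fun=> 0) (@harmonic R)); last 2 first.
- exact: cvg_cst.
- exact: cvg_harmonic.
apply: nearW => l; rewrite u0 /=.
by case: l => [|l]; [case: (Hf (0%N, 0%N))|case: (Hf (l.+1, (phi l).+1))].
Qed.

(** * The limit graphon *)

Section Compactness.
Context {R : realType} {m n : nat -> nat}.
Variables (P : forall k : nat, 'M[R]_(m k, n k)) (U : set_system nat).
Context {UU : UltraFilter U}.
Hypothesis P01 : forall k i j, 0 <= P k i j <= 1.
Hypotheses (m0 : U [set k | (0 < m k)%N]) (n0 : U [set k | (0 < n k)%N]).

(** A level has finitely many relevant breakpoints and values. Each converges along [U], the same
    ultrafilter for all levels, and [L1dist_step_fun] turns this into L1 convergence. *)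
Lemma limit_block_graphons : exists W : nat -> R * R -> R,
  (forall s, graphon_fun (W s)) /\
  (forall s e, 0 < e -> U [set k | (L1dist (block_graphon (P k) s) (W s) <= e%:E)%E]).
Proof.
have /choice[a Ha] : forall sp : nat * nat, exists l : R,
    Ulimit U (fun k => cumfreq (m k) (codes (P k) sp.1).1 sp.2) l.
  by move=> sp; apply: ultra_limit => k; exact: cumfreq_itv.
have /choice[b Hb] : forall sp : nat * nat, exists l : R,
    Ulimit U (fun k => cumfreq (n k) (codes (P k) sp.1).2 sp.2) l.
  by move=> sp; apply: ultra_limit => k; exact: cumfreq_itv.
have /choice[d Hd] : forall spq : nat * (nat * nat), exists l : R,
    Ulimit U (fun k => block_val (P k) spq.1 spq.2.1 spq.2.2) l.
  by move=> spq; apply: ultra_limit => k; exact: block_val_itv.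
have d01 s p q : 0 <= d (s, (p, q)) <= 1 by case: (Hd (s, (p, q))).
exists (fun s => step_fun (fun p q => d (s, (p, q))) (fun p => a (s, p))
  (fun p => b (s, p)) (2 ^ s)); split=> [s|s e e0]; first exact: graphon_step_fun.
pose err k := \sum_(p < 2 ^ s) \sum_(q < 2 ^ s) `|block_val (P k) s p q - d (s, (p : nat, q : nat))| +
   (\sum_(1 <= p < 2 ^ s) `|cumfreq (m k) (codes (P k) s).1 p - a (s, p)| +
    \sum_(1 <= q < 2 ^ s) `|cumfreq (n k) (codes (P k) s).2 q - b (s, q)|).
have serr : usmall U err.
  apply: usmallD; first by apply: usmall_sum => p; apply: usmall_sum => q; exact: (Hd (s, (p : nat, q : nat))).2.
  by apply: usmallD; apply: usmall_sum => p; [exact: (Ha (s, p)).2|exact: (Hb (s, p)).2].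
apply: filterS (serr e e0) => k /= ke.
apply: le_trans (_ : ((err k)%:E <= e%:E)%E); last by rewrite lee_fin.
apply: L1dist_step_fun => //; first by rewrite expn_gt0.
by move=> p q; exact: block_val_itv.
Qed.

Lemma exists_close_graphon : exists W, graphon_fun W /\
  forall e, 0 < e -> U [set k | delta_box_W (P k) W <= e].
Proof.
have [G [gG HG]] := limit_block_graphons.
have /choice[en Hen] : forall s, exists l : R,
    Ulimit U (fun k => level_energy (P k) s) l.
  by move=> s; apply: ultra_limit => k; apply: energy_itv => u; exact: P01.
pose E := sup (range en).
have bE : has_sup (range en).
  split; first by exists (en 0%N), 0%N.
  by exists 1 => _ [s _ <-]; case: (Hen s) => /andP[].
have enE s : en s <= E by apply: ub_le_sup; [exact: bE.2|exists s].
have h0 j : 0 < 2^-1 ^+ j :> R by rewrite exprn_gt0 // invr_gt0.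
have /choice[lev Hlev] : forall j, exists s, E - (2^-1 ^+ j) ^+ 2 < en s.
  move=> j; have [|_ [s _ <-]] := @sup_adherent R _ ((2^-1 ^+ j) ^+ 2) _ bE.
    by rewrite exprn_gt0.
  by exists s.
have dist_le j s t : (s <= t)%N -> en t - en s < (2^-1 ^+ j) ^+ 2 ->
    U [set k | level_dist (P k) s t <= 2^-1 ^+ j].
  (* Half of the slack: the two energies, each off by at most [e], raise the gap to at most
     [(2^-1 ^+ j) ^+ 2]. *)
  move=> st lt; pose e := ((2^-1 ^+ j) ^+ 2 - (en t - en s)) / 2.
  have e0 : 0 < e by rewrite divr_gt0 // subr_gt0.
  apply: filterS2 ((Hen s).2 e e0) ((Hen t).2 e e0) => k /= ks kt.
  have d0 : 0 <= level_dist (P k) s t.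
    by rewrite /level_dist /adist divr_ge0 // sumr_ge0.
  rewrite -ler_sqr ?nnegrE ?(ltW (h0 j)) //.
  apply: le_trans (level_dist_sqr_le _ _ _ st) _.
  move: ks kt; rewrite !ler_norml /e => /andP[? ?] /andP[? ?]; lra.
have close j : (L1dist (G (lev j)) (G (lev j.+1)) <= (2^-1 ^+ j)%:E)%E.
  have near : U [set k | level_dist (P k) (lev j) (lev j.+1) <= 2^-1 ^+ j].
    (* The levels [lev j] need not increase. In either order the coarser one has limit energy within
       [(2^-1 ^+ j) ^+ 2] of [E], which bounds the gap. *)
    have [st|/ltnW st] := leqP (lev j) (lev j.+1).
      by apply: dist_le => //; have := enE (lev j.+1); have := Hlev j; lra.
    have := dist_le j _ _ st; under eq_fun do rewrite level_distC; apply.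
    have : (2^-1 ^+ j.+1) ^+ 2 <= (2^-1 ^+ j) ^+ 2 :> R.
      rewrite ler_sqr ?nnegrE ?(ltW (h0 _)) // exprS ler_piMl ?(ltW (h0 _)) //.
      by rewrite invf_le1 // ler1n.
    by have := enE (lev j); have := Hlev j.+1; lra.
  (* A single index [k] serves as a bridge: its two block graphons are within [e / 2] of their
     limits and at most [2^-1 ^+ j] apart. *)
  apply/lee_addgt0Pr => e e0; have e2 : 0 < e / 2 by rewrite divr_gt0.
  have [k [[kn [km kk]] [k1 k2]]] := filter_ex
    (filterI (filterI near (filterI m0 n0))
      (filterI (HG (lev j) _ e2) (HG (lev j.+1) _ e2))).
  have gk s : graphon_fun (block_graphon (P k) s) by exact: graphon_block_graphon.
  apply: le_trans (L1dist_triangle _ _ _ (gG _) (gk (lev j)) (gG _)) _.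
  rewrite -EFinD (_ : 2^-1 ^+ j + e = e / 2 + (2^-1 ^+ j + e / 2)); last by field.
  rewrite EFinD leeD // 1?L1dist_sym //.
  rewrite L1dist_sym.
  apply: le_trans (L1dist_triangle _ _ _ (gk (lev j)) (gk (lev j.+1)) (gG _)) _.
  by rewrite EFinD leeD // L1dist_block_graphon // lee_fin.
pose W z := limn_sup (fun j => G (lev j) z).
have gW : graphon_fun W by apply: graphon_limn_sup => j; exact: gG.
exists W; split=> // e e0.
(* The budget is four quarters of [e]: one for the one-step distance at level [lev j], one for
   passing from the block graphon to [G (lev j)], and two for the distance [2 * 2^-1 ^+ j] from
   there to [W]. *)
have [j je] : exists j, 2^-1 ^+ j <= e / 4.
  have e4 : 0 < e / 4 by rewrite divr_gt0.
  have [j _ /(_ j (leqnn _)) Hj] := near_infty_natSinv_expn_lt (PosNum e4).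
  by exists j; move: Hj; rewrite /= div1r -exprVn => /ltW.
have lim := L1dist_limn_sup (fun j => G (lev j)) (fun j => gG (lev j)) j close.
have gap := dist_le j (lev j) (lev j).+1 (leqnSn _) ltac:(
  have := enE (lev j).+1; have := Hlev j; lra).
have e4 : 0 < e / 4 by rewrite divr_gt0.
apply: filterS2 (filterI gap (HG (lev j) _ e4)) (filterI m0 n0) => k [kg k1] [km kn].
have gk s : graphon_fun (block_graphon (P k) s) by exact: graphon_block_graphon.
have H : (L1dist (block_graphon (P k) (lev j)) W <= (e / 4 + 2 * 2^-1 ^+ j)%:E)%E.
  apply: le_trans (L1dist_triangle _ _ _ (gk (lev j)) (gG (lev j)) gW) _.
  by rewrite EFinD leeD.
apply: le_trans (delta_box_W_le _ _ km kn _ _ _ gW H) _ => //.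
by move: kg => /=; lra.
Qed.

End Compactness.

Theorem theorem3p4 (R : realType) (m n : nat -> nat)
  (P : forall k : nat, 'M[R]_(m k, n k)) :
  (forall k, binary_mx (P k)) ->
  (forall N : nat, exists K : nat, forall k, (K <= k)%N -> (N <= m k)%N) ->
  (forall N : nat, exists K : nat, forall k, (K <= k)%N -> (N <= n k)%N) ->
  exists (phi : nat -> nat) (W : R * R -> R),
    (forall l, (phi l < phi l.+1)%N) /\
    asym_graphon W /\
    (fun l => delta_box_W (P (phi l)) W) @ \oo --> (0 : R).
Proof.
move=> bin m_oo n_oo.
(* [U] contains every tail of the indices, so eventual properties hold on a set of [U]. *)
have [U [UU oU]] := @ultraFilterLemma nat \oo _.
have P01 k i j : 0 <= P k i j <= 1.
  by case: (bin k i j) => ->; rewrite ?lexx ler01.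
have pos (d : nat -> nat) : (forall N : nat, exists K : nat, forall k, (K <= k)%N -> (N <= d k)%N) ->
    U [set k | (0 < d k)%N].
  by move=> /(_ 1%N)[K HK]; apply: oU; exists K.
have [W [[mW W01] HW]] := exists_close_graphon P U P01 (pos m m_oo) (pos n n_oo).
(* A set of [U] meets every tail, which supplies arbitrarily late indices with small distance to
   [W]. *)
have [phi [phi_lt phi_cvg]] := subsequence_cvg0 (fun k => delta_box_W (P k) W)
  (fun k => delta_box_ge0 _ _) ltac:(
  by move=> e N e0; have [k [k1 k2]] := filter_ex (filterI (oU _ (nbhs_infty_ge N)) (HW e e0));
     exists k).
exists phi, W; split=> //; split=> //; split; first exact: measurable_funTS.
by move=> x y _ _; exact: W01.
Qed.
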